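(* Let $\alpha$ be a monotone self-dual non-projection connective, let $n$ be even, and let the support of $\mu$ comprise exactly the $n$ projection functions. Then the limiting distribution of the growth process $(\mu,\alpha)$ is uniform on the self-dual functions in $\mathcal S_{n/2,n}$.
   Context: A connective is a $k$-adic Boolean function $\alpha:\{0,1\}^k\to\{0,1\}$. The initial distribution $\mu$ is uniform on its support, here $\{x_1,\dots,x_n\}$. The growth process $(\mu,\alpha)$ gives distributions $\pi_i$ on $n$-adic Boolean functions: $\pi_0=\mu$, and for $i\ge1$, $\pi_i(f)$ is the probability that $\alpha(g_1,\dots,g_k)=f$ where $g_1,\dots,g_k$ are independent random functions distributed according to $\pi_{i-1}$. The limiting distribution is $\pi=\lim_{i\to\infty}\pi_i$ (pointwise). A Boolean function $f$ of $m$ variables is self-dual if $f(y_1,\dots,y_m)=\overline{f(\bar y_1,\dots,\bar y_m)}$ for all $y$. The family $\mathcal S_{m,n}$ of slice functions consists of the $n$-adic Boolean functions that take the value 1 on all assignments of weight greater than $m$, the value 0 on all assignments of weight less than $m$, and either value on assignments of weight exactly $m$ (weight = number of ones). *)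

(* Defs.v *)
From mathcomp Require Import all_boot all_order all_algebra.
From mathcomp Require Import all_classical all_reals all_analysis.

Set Implicit Arguments.
Unset Strict Implicit.
Unset Printing Implicit Defensive.

Import Order.TTheory GRing.Theory Num.Theory.
Import numFieldNormedType.Exports.

Local Open Scope ring_scope.

Definition assignment (n : nat) := {ffun 'I_n -> bool}.

Definition boolfun (n : nat) := {ffun assignment n -> bool}.

Definition weight (n : nat) (y : assignment n) : nat := #|[pred i | y i]|.

Definition negate (n : nat) (y : assignment n) : assignment n :=
  [ffun i : 'I_n => ~~ y i].

Definition projection (n : nat) (i : 'I_n) : boolfun n := [ffun y : assignment n => y i].

Definition projections (n : nat) : {set boolfun n} :=
  [set projection i | i : 'I_n]%SET.

Definition monotone_bf (k : nat) (f : boolfun k) : Prop :=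
  forall y z : assignment k, (forall i, y i -> z i) -> f y -> f z.

Definition selfdual (n : nat) (f : boolfun n) : bool :=
  [forall y : assignment n, f y == ~~ f (negate y)].

Definition slice (m n : nat) : {set boolfun n} :=
  [set f : boolfun n | [forall y : assignment n,
     ((m < weight y)%N ==> f y) && ((weight y < m)%N ==> ~~ f y)]]%SET.

Definition compose (k n : nat) (alpha : boolfun k)
    (g : {ffun 'I_k -> boolfun n}) : boolfun n :=
  [ffun y : assignment n => alpha [ffun j => g j y]].

Definition is_distr (R : realType) (T : finType) (p : T -> R) : Prop :=
  (forall x, 0 <= p x) /\ \sum_(x : T) p x = 1.

Definition distr_support (R : realType) (T : finType) (p : T -> R) : {set T} :=
  [set x : T | p x != 0]%SET.

Definition uniform_on (R : realType) (T : finType) (p : T -> R) (A : {set T})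
    : Prop :=
  is_distr p /\ forall x, p x = if x \in A then #|A|%:R^-1 else 0.

(* The tuples g are weighted by the k-fold product of the previous
   distribution, i.e. their entries are independent. *)
Fixpoint growth (R : realType) (k n : nat) (mu : boolfun n -> R)
    (alpha : boolfun k) (i : nat) : boolfun n -> R :=
  if i is i'.+1 then
    fun f => \sum_(g : {ffun 'I_k -> boolfun n} | compose alpha g == f)
               \prod_(j < k) growth mu alpha i' (g j)
  else mu.

Definition limiting_distribution (R : realType) (k n : nat)
    (mu : boolfun n -> R) (alpha : boolfun k) (p : boolfun n -> R) : Prop :=
  forall f : boolfun n, (growth mu alpha i f @[i --> \oo] --> p f)%classic.

(* Main.v *)
Require Import Defs.
From mathcomp Require Import all_boot all_order all_algebra.
From mathcomp Require Import all_classical all_reals all_analysis.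
From mathcomp Require Import ring lra zify.

(* For an assignment [y] of weight below [n/2], the probability that the random
   function is 1 at [y] starts below 1/2 and evolves by the amplification
   function [A] of [alpha].  Hoffman's bound, applied to the intersecting family
   [alpha^-1(1)], gives [A p < p] on (0, 1/2), so this probability tends to 0;
   by self-duality the limit lives on the self-dual slice functions.

   Such a function is determined by its values on the set [M] of assignments of
   weight [n/2] containing a fixed coordinate.  With values +1/-1, let [c_S] be
   the expected product of the values on a subset [S] of [M].  Expanding
   [alpha] in the Fourier basis, [c_S] becomes, up to correlations of proper
   nonempty subsets of [S],
   [\sum_T a_T ^ |S| * c_S ^ |T|], where [a_T] are the Fourier coefficients.
   This is exactly 0 for [|S| = 1].  It is a contraction for [|S| = 2] because
   [alpha] has Fourier weight above level one and initially [|c_S| < 1], and for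
   [|S| > 2] because no [|a_T|] equals 1.  Hence all [c_S] with [S] nonempty
   tend to 0, and Fourier inversion on [M] gives uniformity. *)

Set Implicit Arguments.
Unset Strict Implicit.
Unset Printing Implicit Defensive.

Import Order.TTheory GRing.Theory Num.Theory.
Import numFieldNormedType.Exports.

Local Open Scope ring_scope.
Local Open Scope classical_set_scope.

Lemma prod1D_subsets (R : comNzRingType) (I : finType) (M : {set I})
    (F : I -> R) :
  \prod_(i in M) (1 + F i)
    = \sum_(S : {set I} | S \subset M) \prod_(i in S) F i.
Proof.
rewrite big_mkcond /=.
rewrite (eq_bigr (fun i => (if i \in M then F i else 0) + 1)); last first.
  by move=> i _; case: ifP => _; [rewrite addrC | rewrite add0r].
rewrite bigA_distr [RHS]big_mkcond /=; apply: eq_bigr => S _.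
case: ifPn => [/fintype.subsetP SM | /subsetPn[i iS iM]].
  rewrite [RHS]big_mkcond /=; apply: eq_bigr => i _.
  by case: ifP => // /SM ->.
by rewrite (bigD1 i) //= iS (negbTE iM) mul0r.
Qed.

(** * Biased Fourier analysis on the Boolean cube *)

Section Fourier.
Context {R : realType} {I : finType}.
Variables (w phi : bool -> R) (kappa : R).
(** Completeness relation on one bit: under the weight [w], the functions 1 and [phi] form an
    orthogonal basis, and [kappa] is the inverse squared norm of [phi]. *)
Hypothesis orth :
  forall b c, w c * (1 + kappa * (phi b * phi c)) = (b == c)%:R.

Definition weightp (x : {ffun I -> bool}) : R := \prod_i w (x i).

Definition charac (T : {set I}) (x : {ffun I -> bool}) : R :=
  \prod_(i in T) phi (x i).

Definition coef (f : {ffun I -> bool} -> R) (T : {set I}) : R :=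
  \sum_x weightp x * f x * charac T x.

Lemma fourier_inversion f x :
  f x = \sum_(T : {set I}) kappa ^+ #|T| * coef f T * charac T x.
Proof.
(* The kernel factors over the coordinates, and each factor is an instance of [orth]. *)
have kernel z : \sum_(T : {set I})
      kappa ^+ #|T| * (charac T x * charac T z) * weightp z
    = (x == z)%:R.
  rewrite -mulr_suml (eq_bigr (fun T : {set I} =>
      \prod_(i in T) (kappa * (phi (x i) * phi (z i))))); last first.
    by move=> T _; rewrite -big_split /= -prodr_const -big_split.
  rewrite (eq_bigl (fun T : {set I} => T \subset [set: I]%SET)); last first.
    by move=> T; rewrite ?inE finset.subsetT.
  rewrite -prod1D_subsets /weightp mulrC.
  rewrite [X in _ * X](eq_bigl xpredT) => [|i]; last by rewrite finset.in_setT.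
  rewrite -big_split /=.
  rewrite (eq_bigr (fun i => (x i == z i)%:R)); last by move=> i _; apply: orth.
  have [->|/eqP xz] := eqVneq x z.
    by rewrite big1 // => i _; rewrite eqxx.
  have [i xi] : exists i, x i != z i.
    apply/existsP; rewrite -negb_forall; apply/forallP => /= H.
    by apply: xz; apply/ffunP => i; apply/eqP.
  by rewrite (bigD1 i) //= (negbTE xi) mul0r.
rewrite (eq_bigr (fun T : {set I} => \sum_z
    f z * (kappa ^+ #|T| * (charac T x * charac T z) * weightp z))); last first.
  move=> T _; rewrite /coef mulr_sumr mulr_suml; apply: eq_bigr => z _; ring.
rewrite exchange_big /= (eq_bigr (fun z => f z * (x == z)%:R)); last first.
  by move=> z _; rewrite -mulr_sumr kernel.
rewrite (bigD1 x) //= eqxx mulr1 big1 ?addr0 // => z /negbTE zx.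
by rewrite eq_sym zx mulr0.
Qed.

(* [nu] is the law of one coordinate of a coupled pair of assignments; its
   transition operator has eigenvector [phi] with eigenvalue [theta]. *)
Lemma coupled_mean (nu : bool -> bool -> R) (theta : R)
    (f : {ffun I -> bool} -> R) :
  (forall b, nu b true + nu b false = w b) ->
  (forall b, nu b true * phi true + nu b false * phi false
             = theta * w b * phi b) ->
  \sum_(x : {ffun I -> bool}) \sum_(y : {ffun I -> bool})
      (\prod_i nu (x i) (y i)) * (f x * f y)
    = \sum_(T : {set I}) kappa ^+ #|T| * theta ^+ #|T| * coef f T ^+ 2.
Proof.
move=> nu1 nuphi.
have nu_charac (T : {set I}) (x : {ffun I -> bool}) : \sum_(y : {ffun I -> bool})
    (\prod_i nu (x i) (y i)) * charac T y
    = theta ^+ #|T| * (weightp x * charac T x).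
  rewrite (eq_bigr (fun y : {ffun I -> bool} =>
      \prod_i (nu (x i) (y i) * (if i \in T then phi (y i) else 1)))); last first.
    by move=> y _; rewrite /charac [X in _ * X]big_mkcond /= -big_split.
  rewrite -(bigA_distr_bigA (fun i b =>
    nu (x i) b * (if i \in T then phi b else 1))) /=.
  rewrite /charac [X in _ * (_ * X)]big_mkcond /= -prodr_const.
  rewrite [X in X * _]big_mkcond /= -!big_split /=; apply: eq_bigr => i _.
  rewrite big_bool /=; case: ifP => _; last by rewrite !mulr1 nu1 mul1r.
  by rewrite nuphi mulrA.
rewrite (eq_bigr (fun x => \sum_(T : {set I})
    kappa ^+ #|T| * theta ^+ #|T| * coef f T * (weightp x * f x * charac T x))); last first.
  move=> x _.
  rewrite (eq_bigr (fun y : {ffun I -> bool} => \sum_(T : {set I})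
      f x * kappa ^+ #|T| * coef f T *
      ((\prod_i nu (x i) (y i)) * charac T y))); last first.
    move=> y _; rewrite (fourier_inversion f y) !mulr_sumr.
    by apply: eq_bigr => T _; ring.
  rewrite exchange_big; apply: eq_bigr => T _ /=.
  by rewrite -mulr_sumr nu_charac; ring.
rewrite exchange_big; apply: eq_bigr => T _ /=.
by rewrite -mulr_sumr expr2 mulrA.
Qed.

Lemma parseval f :
  \sum_(T : {set I}) kappa ^+ #|T| * coef f T ^+ 2 = \sum_x weightp x * f x ^+ 2.
Proof.
rewrite (eq_bigr (fun T : {set I} => \sum_x kappa ^+ #|T| * coef f T *
    (weightp x * f x * charac T x))); last first.
  by move=> T _; rewrite -mulr_sumr expr2 mulrA.
rewrite exchange_big; apply: eq_bigr => x _ /=.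
rewrite expr2 mulrA [X in _ = _ * X](fourier_inversion f x) mulr_sumr.
by apply: eq_bigr => T _; ring.
Qed.

Lemma coef0 f : coef f finset.set0 = \sum_x weightp x * f x.
Proof. by apply: eq_bigr => x _; rewrite /charac big_set0 mulr1. Qed.

Lemma sum_weightp : w true + w false = 1 -> \sum_x weightp x = 1.
Proof.
move=> w1; rewrite -(bigA_distr_bigA (fun=> w)) /= big1 // => i _.
by rewrite big_bool.
Qed.

(* Functions of degree at most one are affine, so their total variation from
   [0] to [1] is the sum of their variations along the coordinate axes. *)
Lemma high_degree_coef f :
  (forall i, f [ffun j => j == i] = f [ffun=> false]) ->
  f [ffun=> true] != f [ffun=> false] ->
  exists T : {set I}, (1 < #|T|)%N /\ coef f T != 0.
Proof.
move=> f_unit f_ones; apply/not_existsP => coef_low.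
have affine (T : {set I}) : (#|T| <= 1)%N ->
    charac T [ffun=> true] - charac T [ffun=> false]
    = \sum_i (charac T [ffun j => j == i] - charac T [ffun=> false]).
  rewrite leq_eqVlt ltnS leqn0 => /orP[/cards1P[j ->]|/eqP T0].
    rewrite (bigD1 j) //= big1 ?addr0 => [|i ij].
      by rewrite /charac !big_set1 !ffunE eqxx.
    by rewrite /charac !big_set1 !ffunE eq_sym (negbTE ij) subrr.
  rewrite (cards0_eq T0) big1 => [|i _].
    by rewrite /charac !big_set0 subrr.
  by rewrite /charac !big_set0 subrr.
have : f [ffun=> true] - f [ffun=> false]
    = \sum_i (f [ffun j => j == i] - f [ffun=> false]).
  rewrite [X in X - _]fourier_inversion [X in _ - X]fourier_inversion -sumrB.
  under [RHS]eq_bigr => i _.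
    rewrite [X in X - _]fourier_inversion [X in _ - X]fourier_inversion -sumrB.
    over.
  rewrite exchange_big; apply: eq_bigr => T _ /=.
  have [T1|T2] := leqP #|T| 1.
    rewrite -mulrBr affine // mulr_sumr.
    by apply: eq_bigr => i _; rewrite mulrBr.
  have -> : coef f T = 0.
    by apply/eqP/negP => /negP cT; apply: (coef_low T).
  by rewrite mulr0 !mul0r subrr big1 // => i _; rewrite !mul0r subrr.
rewrite big1 => [/eqP|i _]; last by rewrite f_unit subrr.
by rewrite subr_eq0 (negbTE f_ones).
Qed.

End Fourier.

(** * Monotone self-dual connectives *)

Lemma negateK n : involutive (@negate n).
Proof. by move=> y; apply/ffunP => i; rewrite !ffunE negbK. Qed.

Section Connective.
Context {k : nat}.
Variable alpha : boolfun k.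
Hypothesis alpha_monotone : monotone_bf alpha.
Hypothesis alpha_selfdual : selfdual alpha.

Lemma selfdualE y : alpha (negate y) = ~~ alpha y.
Proof. by rewrite (eqP (forallP alpha_selfdual y)) negbK. Qed.

(** Otherwise [y] lies below [negate x], and monotonicity makes [alpha (negate x)] true, against
    self-duality. *)
Lemma monotone_selfdual_intersecting x y :
  alpha x -> alpha y -> exists i, x i && y i.
Proof.
move=> ax ay; apply/existsP/negbNE; rewrite negb_exists.
apply/negP => /forallP xy; have: alpha (negate x).
  apply: alpha_monotone ay => i yi; rewrite ffunE; apply/negP => xi.
  by have := xy i; rewrite xi yi.
by rewrite selfdualE ax.
Qed.

Lemma alpha_zero : alpha [ffun=> false] = false.
Proof.
apply/negP => a0; have [i] := monotone_selfdual_intersecting a0 a0.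
by rewrite ffunE.
Qed.

Lemma alpha_ones : alpha [ffun=> true].
Proof.
have -> : [ffun=> true] = negate [ffun i : 'I_k => false].
  by apply/ffunP => i; rewrite !ffunE.
by rewrite selfdualE alpha_zero.
Qed.

Hypothesis alpha_nonprojection : alpha \notin projections k.

(** A single true input that forces [alpha] would, by monotonicity and duality, make [alpha] the
    projection on [j]. *)
Lemma alpha_unit j : alpha [ffun i => i == j] = false.
Proof.
apply/negP => aj; case/negP: alpha_nonprojection.
have up (y : assignment k) : y j -> alpha y.
  by move=> yj; apply: alpha_monotone aj => i; rewrite ffunE => /eqP ->.
apply/imsetP; exists j => //; apply/ffunP => y; rewrite ffunE.
case: (boolP (y j)) => [/up //|yj].
by apply/negbTE; rewrite -selfdualE; apply: up; rewrite ffunE.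
Qed.

Context {R : realType}.
Implicit Types (p : R).

Definition bias p (b : bool) : R := if b then p else 1 - p.

(** The variable b - p, of variance p (1 - p); hence the constant in [bias_orth]. *)
Definition centred p (b : bool) : R := if b then 1 - p else - p.

Definition amplification p : R :=
  \sum_x weightp (bias p) x * (alpha x)%:R.

Lemma bias_orth p : 0 < p < 1 -> forall b c, bias p c *
  (1 + (p * (1 - p))^-1 * (centred p b * centred p c)) = (b == c)%:R.
Proof.
move=> /andP[p0 p1]; have p0' := lt0r_neq0 p0.
have p1' : 1 - p != 0 by rewrite subr_eq0 gt_eqF.
by case; case; rewrite /bias /centred /=; field; rewrite ?p0' ?p1'.
Qed.

Lemma amplification_ge0 p : 0 <= p <= 1 -> 0 <= amplification p.
Proof.
move=> /andP[p0 p1]; apply: sumr_ge0 => x _; apply: mulr_ge0 => //.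
by apply: prodr_ge0 => i _; rewrite /bias; case: ifP => // _; rewrite subr_ge0.
Qed.

(* Hoffman's ratio bound for the intersecting family [alpha^-1(1)]: couple two
   [p]-biased assignments so that they are almost surely disjoint. *)
Lemma amplification_lt p : 0 < p < 2^-1 -> amplification p < p.
Proof.
move=> /andP[p0 p12]; have p01 : 0 < p < 1 by rewrite p0 /=; lra.
have orth := bias_orth p01.
set f : assignment k -> R := fun x => (alpha x)%:R.
pose kappa := (p * (1 - p))^-1; pose lambda := p / (1 - p).
have kappa0 : 0 < kappa by rewrite invr_gt0 mulr_gt0 //; lra.
have lambda0 : 0 < lambda by rewrite divr_gt0 //; lra.
have lambda1 : lambda < 1 by rewrite ltr_pdivrMr; lra.
(* Joint law of two bits that are never both 1 and are each 1 with probability p; its eigenvalue on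
   the centred bit is - p / (1 - p). *)
have := @coupled_mean R 'I_k _ _ _ orth
  (fun b c => if b then if c then 0 else p else if c then p else 1 - p - p)
  (- lambda) f _ _.
rewrite -/kappa big1 => [|x _]; last first.
  rewrite big1 // => y _; rewrite /f.
  have [ax|] := boolP (alpha x); last by rewrite mul0r mulr0.
  have [ay|] := boolP (alpha y); last by rewrite !mulr0.
  have [i /andP[xi yi]] := monotone_selfdual_intersecting ax ay.
  by rewrite (bigD1 i) //= xi yi !mul0r.
move=> hoffman.
have {}hoffman : 0 = \sum_(T : {set 'I_k})
    kappa ^+ #|T| * (- lambda) ^+ #|T| *
    coef (bias p) (centred p) f T ^+ 2.
  apply: hoffman; case; rewrite /bias /centred /lambda; field; lra.
have parsev := parseval orth f; rewrite -/kappa in parsev.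
have Ap : \sum_x weightp (bias p) x * f x ^+ 2 = amplification p.
  by apply: eq_bigr => x _; rewrite /f; case: (alpha x); rewrite ?expr1n ?expr0n.
rewrite Ap in parsev.
have [T0 [T01 cT0]] : exists T : {set 'I_k},
    (1 < #|T|)%N /\ coef (bias p) (centred p) f T != 0.
  apply: (high_degree_coef orth).
    by move=> i; rewrite /f alpha_unit alpha_zero.
  by rewrite /f alpha_zero alpha_ones oner_neq0.
pose A := amplification p.
(* Add [lambda] times Parseval to [hoffman]. The empty set contributes the left-hand side; the other
   factors [(- lambda) ^+ #|T| + lambda] are nonnegative, vanish at level one, and are positive at
   [T0]. *)
have key : (1 + lambda) * A ^+ 2 < lambda * A.
  have : lambda * A = \sum_(T : {set 'I_k}) kappa ^+ #|T| *
      coef (bias p) (centred p) f T ^+ 2 * ((- lambda) ^+ #|T| + lambda).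
    rewrite -[LHS]add0r [X in X + _]hoffman /A -parsev mulr_sumr -big_split /=.
    by apply: eq_bigr => T _; ring.
  move=> ->; rewrite (bigD1 finset.set0) //= (bigD1 T0) /=; last first.
    by rewrite -card_gt0 ltnW.
  rewrite cards0 !expr0 mul1r coef0 -[X in X < _]addr0 mulrC ltrD2l.
  have pos (T : {set 'I_k}) : T != finset.set0 -> 0 <= kappa ^+ #|T| *
      coef (bias p) (centred p) f T ^+ 2 * ((- lambda) ^+ #|T| + lambda).
    rewrite -card_gt0 => T0'.
    apply: mulr_ge0; first by rewrite mulr_ge0 ?sqr_ge0 ?exprn_ge0 // ltW.
    rewrite addrC -lerBlDl sub0r.
    apply: lerNnormlW; rewrite normrX normrN gtr0_norm //.
    by rewrite -(prednK T0') exprS ler_piMr ?exprn_ile1 // ltW.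
  rewrite ltr_pwDl //; last first.
    by apply: sumr_ge0 => T /andP[T0' _]; apply: pos.
  apply: mulr_gt0; first by rewrite mulr_gt0 ?(exprn_gt0 _ kappa0) // exprn_even_gt0.
  rewrite addrC -ltrBlDl sub0r; apply: ltrNnormlW.
  rewrite normrX normrN gtr0_norm //.
  by case: #|T0| T01 => [|[|m]] // _; rewrite exprS gtr_pMr // exprn_ilt1 // ltW.
have A0 : 0 <= A by apply: amplification_ge0; lra.
rewrite ltNge; apply/negP; rewrite -/A => pA.
(* Since [lambda / (1 + lambda) = p], [key] amounts to [A ^+ 2 < p * A]. *)
move: key; have -> : 1 + lambda = (1 - p)^-1 by rewrite /lambda; field; lra.
rewrite /lambda -[X in _ < X]mulrA (mulrCA p) ltr_pM2l ?invr_gt0; last by lra.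
by rewrite ltNge expr2 ler_wpM2r.
Qed.

(** A constant function, so that a fair bit fits the one-bit weight [w] of the biased theory. *)
Definition half (b : bool) : R := 2^-1.

Definition sgn (b : bool) : R := if b then 1 else -1.

Lemma sgn_orth b c : half c * (1 + 1 * (sgn b * sgn c)) = (b == c)%:R.
Proof. by rewrite /half /sgn; case: b; case: c => /=; field. Qed.

Definition fcoef (T : {set 'I_k}) : R :=
  coef half sgn (fun x => sgn (alpha x)) T.

Lemma sgn_negb b : sgn (~~ b) = - sgn b.
Proof. by rewrite /sgn; case: b; rewrite ?opprK. Qed.

Lemma fcoef_expansion (x : assignment k) :
  sgn (alpha x) = \sum_(T : {set 'I_k}) fcoef T * charac sgn T x.
Proof.
rewrite [LHS](fourier_inversion sgn_orth (fun x => sgn (alpha x))).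
by apply: eq_bigr => T _; rewrite expr1n mul1r.
Qed.

Lemma fcoef_parseval : \sum_T fcoef T ^+ 2 = 1.
Proof.
have := parseval sgn_orth (fun x : assignment k => sgn (alpha x)).
under eq_bigr do rewrite expr1n mul1r.
move=> ->; rewrite -[RHS](@sum_weightp R 'I_k half) /half; last by field.
apply: eq_bigr => x _; rewrite /sgn; case: (alpha x) => /=.
  by rewrite expr1n mulr1.
by rewrite sqrrN expr1n mulr1.
Qed.

Lemma fcoef_norm_le1 T : `|fcoef T| <= 1.
Proof.
rewrite -(@expr_le1 _ 2) // real_normK ?num_real // -fcoef_parseval.
by rewrite (bigD1 T) //= lerDl; apply: sumr_ge0 => U _; apply: sqr_ge0.
Qed.

Lemma fcoef0 : fcoef finset.set0 = 0.
Proof.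
rewrite /fcoef coef0; set s := \sum_x _.
suff : s = - s by lra.
rewrite {1}/s (reindex_inj (inv_inj (@negateK k))) /= -sumrN.
by apply: eq_bigr => x _; rewrite selfdualE sgn_negb mulrN.
Qed.

Lemma fcoef_high_degree :
  exists T : {set 'I_k}, (1 < #|T|)%N /\ fcoef T != 0.
Proof.
apply: (high_degree_coef sgn_orth).
  by move=> i; rewrite alpha_unit alpha_zero.
by rewrite alpha_zero alpha_ones /sgn gt_eqF // ltrN10.
Qed.

(** By Parseval, a coefficient of modulus 1 makes [sgn (alpha x)] a signed parity on [T]. Raising
    one coordinate of [T] from the zero assignment would flip its sign, but [alpha] is 0 at both
    points. *)
Lemma fcoef_norm_lt1 T : `|fcoef T| < 1.
Proof.
rewrite ltNge; apply/negP => T1.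
have T2 : 1 <= fcoef T ^+ 2 by rewrite -real_normK ?num_real // expr_ge1.
have others U : U != T -> fcoef U = 0.
  move=> UT; apply/eqP; rewrite -sqrf_eq0; apply/eqP/le_anti.
  rewrite sqr_ge0 andbT; have := fcoef_parseval.
  rewrite (bigD1 T) //= (bigD1 U) //=.
  have : 0 <= \sum_(i | (i != T) && (i != U)) fcoef i ^+ 2.
    by apply: sumr_ge0 => i _; apply: sqr_ge0.
  lra.
have [U [U1 U0]] := fcoef_high_degree.
have UT : U = T by apply/eqP/negPn/negP => /others /eqP; apply/negP.
have [i iT] : exists i, i \in T by apply/card_gt0P; rewrite -UT ltnW.
have expand (x : assignment k) : sgn (alpha x) = fcoef T * charac sgn T x.
  rewrite fcoef_expansion (bigD1 T) //= big1 ?addr0 // => V /others ->.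
  by rewrite mul0r.
have := expand [ffun j => j == i].
have -> : charac sgn T [ffun j => j == i] = - charac sgn T [ffun=> false].
  rewrite /charac (bigD1 i) //= [X in - X](bigD1 i) //= !ffunE eqxx /=.
  rewrite mul1r mulN1r opprK; apply: eq_bigr => j /andP[_ /negbTE ji].
  by rewrite !ffunE ji.
rewrite mulrN -expand alpha_unit alpha_zero /sgn; lra.
Qed.

Definition fcoef_cube : R := \sum_T `|fcoef T| ^+ 3.

(** The squares of the coefficients sum to 1, and cubing strictly decreases a nonzero term because
    its modulus is below 1. *)
Lemma fcoef_cube_lt1 : 0 <= fcoef_cube < 1.
Proof.
apply/andP; split; first by apply: sumr_ge0 => T _; apply: exprn_ge0.
have [U [_ U0]] := fcoef_high_degree.
rewrite -fcoef_parseval /fcoef_cube (bigD1 U) //= [ltRHS](bigD1 U) //=.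
have le3 T : `|fcoef T| ^+ 3 <= fcoef T ^+ 2.
  by rewrite exprSr real_normK ?num_real // ler_piMr ?sqr_ge0 // ltW ?fcoef_norm_lt1.
apply: ltr_leD; last by apply: ler_sum => T _; apply: le3.
rewrite exprSr real_normK ?num_real // gtr_pMr ?fcoef_norm_lt1 //.
by rewrite exprn_even_gt0.
Qed.

(** The empty set has coefficient 0, so every surviving term carries a factor |c|; since the
    coefficients have modulus at most 1, exponent 3 is the worst case. *)
Lemma fcoef_contraction3 (m : nat) (c : R) : (2 < m)%N -> `|c| <= 1 ->
  \sum_(T : {set 'I_k}) `|fcoef T| ^+ m * `|c| ^+ #|T| <= fcoef_cube * `|c|.
Proof.
move=> m3 c1; rewrite /fcoef_cube mulr_suml; apply: ler_sum => T _.
have [->|T0] := eqVneq T finset.set0.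
  by rewrite fcoef0 normr0 !expr0n; case: m m3 => // m _; rewrite !mul0r.
apply: ler_pM; rewrite ?exprn_ge0 //.
  by apply: ler_wiXn2l => //; apply/ltW/fcoef_norm_lt1.
move: T0; rewrite -card_gt0; case: #|T| => // t _.
by rewrite exprS ler_piMr ?exprn_ile1.
Qed.

Definition fcoef_tail : R := \sum_(T : {set 'I_k} | (1 < #|T|)%N) fcoef T ^+ 2.

Lemma fcoef_tail_bounds : 0 < fcoef_tail <= 1.
Proof.
apply/andP; split.
  have [U [U1 U0]] := fcoef_high_degree.
  rewrite /fcoef_tail (bigD1 U) //= ltr_pwDl // ?exprn_even_gt0 //.
  by apply: sumr_ge0 => i _; apply: sqr_ge0.
rewrite -fcoef_parseval [leRHS](bigID (fun T : {set 'I_k} => (1 < #|T|)%N)) /=.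
by rewrite lerDl; apply: sumr_ge0 => i _; apply: sqr_ge0.
Qed.

(** The squared coefficients already sum to 1, so the gain comes from the powers of |c|: above level
    one, |c| is replaced by at most its square. The rate depends on c and is below 1 only if |c| <
    1. *)
Lemma fcoef_contraction2 (c : R) : `|c| <= 1 ->
  \sum_(T : {set 'I_k}) `|fcoef T| ^+ 2 * `|c| ^+ #|T|
    <= (1 - (1 - `|c|) * fcoef_tail) * `|c|.
Proof.
move=> c1.
have -> : (1 - (1 - `|c|) * fcoef_tail) * `|c| =
    \sum_(T : {set 'I_k}) fcoef T ^+ 2 * `|c|
    - \sum_(T : {set 'I_k} | (1 < #|T|)%N) fcoef T ^+ 2 * (`|c| - `|c| ^+ 2).
  by rewrite -!mulr_suml fcoef_parseval -/fcoef_tail; ring.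
rewrite [X in _ - X]big_mkcond /= -sumrB; apply: ler_sum => T _.
rewrite real_normK ?num_real //.
have [->|] := eqVneq T finset.set0.
  by rewrite fcoef0 cards0 expr0n /= !mul0r subr0.
rewrite -card_gt0; case: #|T| => [|[|t]] // _ /=.
  by rewrite expr1 subr0.
rewrite -mulrBr ler_wpM2l ?sqr_ge0 //.
have -> : `|c| - (`|c| - `|c| ^+ 2) = `|c| ^+ 2 by ring.
exact: ler_wiXn2l.
Qed.

End Connective.

Lemma cvg0_contraction (R : realType) (u e : nat -> R) (lambda : R) :
  0 <= lambda < 1 -> (forall i, 0 <= u i) ->
  (forall i, u i.+1 <= lambda * u i + e i) ->
  (e i @[i --> \oo] --> 0) -> (u i @[i --> \oo] --> 0).
Proof.
move=> /andP[l0 l1] u0 ustep e0; apply/cvgrPdist_lt => eps eps0.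
have l1' : 0 < 1 - lambda by rewrite subr_gt0.
(* With this bound on the error, eps / 2 is the fixed point of the perturbed recursion. *)
have d0 : 0 < eps / 2 * (1 - lambda) by rewrite mulr_gt0 // divr_gt0.
move/cvgrPdist_lt : e0 => /(_ _ d0)[N _ eN].
have bound j : u (N + j)%N <= u N * lambda ^+ j + eps / 2.
  elim: j => [|j IHj]; first by rewrite addn0 expr0 mulr1; lra.
  rewrite addnS; apply: (le_trans (ustep _)).
  have : e (N + j)%N < eps / 2 * (1 - lambda).
    have := eN (N + j)%N (leq_addr _ _); rewrite sub0r normrN.
    exact/le_lt_trans/ler_norm.
  have := ler_wpM2l l0 IHj; rewrite mulrDr mulrCA -exprS; lra.
have l1n : `|lambda| < 1 by rewrite ger0_norm.
have /cvgrPdist_lt := cvg_geometric (u N) l1n.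
have eps2 : 0 < eps / 2 by rewrite divr_gt0.
move=> /(_ _ eps2)[J _ gJ].
exists (N + J)%N => // i /= iNJ; rewrite sub0r normrN ger0_norm //.
have Ni : (N <= i)%N by apply: leq_trans iNJ; apply: leq_addr.
rewrite -(subnKC Ni); apply: (le_lt_trans (bound _)).
have /gJ : (J <= i - N)%N by rewrite leq_subRL.
rewrite /geometric /= sub0r normrN => /(le_lt_trans (ler_norm _)); lra.
Qed.

(** * Evolution of point probabilities and correlations *)

Section Growth.
Context {R : realType} {k n : nat}.
Variables (mu : boolfun n -> R) (alpha : boolfun k).
Hypothesis mu_distr : is_distr mu.

Definition growth_mean (i : nat) (F : boolfun n -> R) : R :=
  \sum_f growth mu alpha i f * F f.

Lemma growth_meanS i F : growth_mean i.+1 F =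
  \sum_(g : {ffun 'I_k -> boolfun n})
    (\prod_j growth mu alpha i (g j)) * F (compose alpha g).
Proof.
rewrite [RHS](partition_big (fun g => compose alpha g) xpredT) //=.
apply: eq_bigr => f _; rewrite mulr_suml.
by apply: eq_bigr => g /eqP ->.
Qed.

Lemma growth_mean_tensor i (F : 'I_k -> boolfun n -> R) :
  \sum_(g : {ffun 'I_k -> boolfun n})
    (\prod_j growth mu alpha i (g j)) * (\prod_j F j (g j))
  = \prod_j growth_mean i (F j).
Proof.
rewrite /growth_mean (bigA_distr_bigA (fun j f => growth mu alpha i f * F j f)).
by apply: eq_bigr => g _; rewrite big_split.
Qed.

Lemma growth_distr i : is_distr (growth mu alpha i).
Proof.
elim: i => [//|i [IH0 IH1]]; split => [f|].
  by rewrite /=; apply: sumr_ge0 => g _; apply: prodr_ge0.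
have -> : \sum_f growth mu alpha i.+1 f = growth_mean i.+1 (fun=> 1).
  by apply: eq_bigr => f _; rewrite mulr1.
rewrite growth_meanS; transitivity (\prod_(j < k) growth_mean i (fun=> 1)).
  by rewrite -growth_mean_tensor; apply: eq_bigr => g _; rewrite big1_eq.
rewrite big1 // => j _.
by rewrite /growth_mean -[RHS]IH1; apply: eq_bigr => f _; rewrite mulr1.
Qed.

Lemma growth_ge0 i f : 0 <= growth mu alpha i f.
Proof. by case: (growth_distr i). Qed.

(** A function of nonzero probability is a composite of functions of nonzero probability one stage
    earlier, and composition preserves self-duality. *)
Lemma growth_selfdual i f : selfdual alpha ->
  (forall f, mu f != 0 -> selfdual f) ->
  growth mu alpha i f != 0 -> selfdual f.
Proof.
move=> sd_alpha sd_mu; elim: i f => [//|i IH] f /= fnz.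
have [g /eqP gf gnz] : exists2 g : {ffun 'I_k -> boolfun n},
    compose alpha g == f & \prod_j growth mu alpha i (g j) != 0.
  apply/exists2P/not_existsP => H; move/eqP: fnz; apply; apply: big1 => g gf.
  by apply/eqP/negPn/negP => gnz; apply: (H g).
rewrite -gf; apply/forallP => y; rewrite !ffunE.
rewrite (eqP (forallP sd_alpha _)); apply/eqP; congr (~~ alpha _).
apply/ffunP => j; rewrite !ffunE.
have /IH /forallP /(_ (negate y)) /eqP -> : growth mu alpha i (g j) != 0.
  by move/prodf_neq0: gnz => /(_ j isT).
by rewrite negateK.
Qed.

Definition prob1 (i : nat) (y : assignment n) : R :=
  growth_mean i (fun f => (f y)%:R).

Lemma growth_mean_compl i F :
  growth_mean i (fun f => 1 - F f) = 1 - growth_mean i F.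
Proof.
rewrite /growth_mean; under eq_bigr do rewrite mulrBr mulr1.
by rewrite sumrB; congr (_ - _); case: (growth_distr i).
Qed.

Lemma prob1S i y : prob1 i.+1 y = amplification alpha (prob1 i y).
Proof.
rewrite /prob1 growth_meanS /amplification.
under eq_bigr => g _.
  (* Expand [alpha] over the possible values [x] of the vector of bits [g j y]; the indicator of
     each value factors over [j]. *)
  rewrite (_ : (compose alpha g y)%:R = \sum_(x : assignment k)
    (\prod_j (g j y == x j)%:R) * (alpha x)%:R); last first.
    rewrite (bigD1 [ffun j => g j y]) //= big1 => [|j _]; last by rewrite ffunE eqxx.
    rewrite mul1r big1 => [|x xg]; last first.
      have [j xj] : exists j, g j y != x j.
        apply/existsP; rewrite -negb_forall; apply/forallP => H.
        by case/eqP: xg; apply/ffunP => j; rewrite ffunE (eqP (H j)).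
      by rewrite (bigD1 j) //= (negbTE xj) !mul0r.
    by rewrite ffunE addr0.
  rewrite mulr_sumr; over.
rewrite exchange_big; apply: eq_bigr => x _ /=.
under eq_bigr do rewrite mulrA.
rewrite -mulr_suml (growth_mean_tensor i (fun j f => (f y == x j)%:R)).
congr (_ * _); apply: eq_bigr => j _; rewrite /bias.
case: (x j); first by apply: eq_bigr => f _; rewrite eqb_id.
rewrite -growth_mean_compl; apply: eq_bigr => f _.
by case: (f y); rewrite ?subrr ?subr0.
Qed.

Lemma prob1_bounds i y : 0 <= prob1 i y <= 1.
Proof.
have [p0 p1] := growth_distr i; apply/andP; split.
  by apply: sumr_ge0 => f _; apply: mulr_ge0.
rewrite -p1; apply: ler_sum => f _.
by rewrite ler_piMr // lern1 leq_b1.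
Qed.

(** The function [f] is itself a point of the cube indexed by assignments, and [charac] is a
    character of that cube. *)
Definition corr (i : nat) (S : {set assignment n}) : R :=
  growth_mean i (fun f => charac (@sgn R) S f).

Lemma corr_set0 i : corr i finset.set0 = 1.
Proof.
rewrite /corr /growth_mean; have [_ <-] := growth_distr i.
by apply: eq_bigr => f _; rewrite /charac big_set0 mulr1.
Qed.

Lemma corr_norm_le1 i S : `|corr i S| <= 1.
Proof.
have [p0 <-] := growth_distr i; rewrite (le_trans (ler_norm_sum _ _ _)) //.
apply: ler_sum => f _; rewrite normrM ger0_norm // /charac normr_prod.
rewrite big1 ?mulr1 // => y _.
by rewrite /sgn; case: (f y); rewrite ?normrN normr1.
Qed.

(** Expanding [alpha] at each [y] in [S] chooses a frequency [tau y]. By independence, the points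
    whose frequency contains [j] are grouped into one correlation for the argument [j]. Outside [S],
    [tau] takes the empty set as default value. *)
Lemma corrS i S : corr i.+1 S =
  \sum_(tau in pffun_on finset.set0 S predT)
    (\prod_(y in S) fcoef alpha (tau y)) *
    \prod_(j < k) corr i [set y in S | j \in tau y]%SET.
Proof.
rewrite /corr growth_meanS.
under eq_bigr => g _.
  rewrite /charac.
  under [X in _ * X]eq_bigr => y _ do rewrite ffunE fcoef_expansion.
  rewrite (big_distr_big finset.set0) /= mulr_sumr.
  over.
rewrite exchange_big; apply: eq_bigr => tau _ /=.
rewrite -growth_mean_tensor mulr_sumr; apply: eq_bigr => g _.
rewrite big_split /= mulrCA; congr (_ * (_ * _)).
rewrite /charac (exchange_big_dep predT) //=; apply: eq_bigr => j _.
rewrite [RHS](eq_bigl (fun y => (y \in S) && (j \in tau y))) => [|y]; last by rewrite !inE.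
by apply: eq_bigr => y _; rewrite ffunE.
Qed.

(** The first sum bounds the [tau] constant on [S], for which each set in [corrS] is [S] or empty.
    For any other [tau], some [j] separates two points of [S] and yields the correlation of a proper
    nonempty subset; the remaining factors have modulus at most 1. *)
Lemma corr_step i (S : {set assignment n}) y0 : y0 \in S ->
  `|corr i.+1 S| <=
    \sum_(T : {set 'I_k}) `|fcoef alpha T : R| ^+ #|S| * `|corr i S| ^+ #|T|
    + #|{ffun assignment n -> {set 'I_k}}|%:R *
      \sum_(U : {set assignment n} | (U != finset.set0) && (U \proper S))
         `|corr i U|.
Proof.
move=> y0S; rewrite corrS (le_trans (ler_norm_sum _ _ _)) //.
rewrite (bigID (fun tau : {ffun assignment n -> {set 'I_k}} =>
  [forall y in S, tau y == tau y0])) /=; apply: lerD.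
  pose h (T : {set 'I_k}) : {ffun assignment n -> {set 'I_k}} :=
    [ffun y => if y \in S then T else finset.set0].
  rewrite (reindex_onto h (fun tau => tau y0)) /=; last first.
    move=> tau /andP[/pffun_onP[/fintype.subsetP tauS _] /forall_inP tau_const].
    apply/ffunP => y; rewrite ffunE; case: ifPn => [/tau_const /eqP -> //|yS].
    by apply/esym/eqP/negPn; apply: contra yS => yS; apply: tauS.
  rewrite [leRHS]big_mkcond [leLHS]big_mkcond /=; apply: ler_sum => T _.
  case: ifP => [_|_]; last by rewrite mulr_ge0 ?exprn_ge0.
  rewrite normrM (eq_bigr (fun=> fcoef alpha T)) => [|y yS]; last first.
    by rewrite ffunE yS.
  rewrite prodr_const normrX normr_prod ler_wpM2l ?exprn_ge0 //.
  rewrite -prodr_const [leRHS]big_mkcond /=; apply: ler_prod => j _.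
  rewrite normr_ge0 /=; case: ifPn => jT.
    suff -> : [set y in S | j \in h T y]%SET = S by [].
    by apply/setP => y; rewrite !inE ffunE; case: ifP => //=; rewrite jT.
  exact: corr_norm_le1.
set rest := \sum_(U : {set assignment n} | _) _.
apply: (@le_trans _ _ (\sum_(tau : {ffun assignment n -> {set 'I_k}}) rest)).
  rewrite big_mkcond /=; apply: ler_sum => tau _.
  have rest0 : 0 <= rest by apply: sumr_ge0.
  case: ifP => // /andP[_]; rewrite negb_forall_in => /exists_inP[y1 y1S tau10].
  have [j jtau] : exists j, (j \in tau y1) != (j \in tau y0).
    apply/existsP; rewrite -negb_forall; apply: contra tau10 => /forallP H.
    by apply/eqP/setP => j; rewrite (eqP (H j)).
  set U := [set y in S | j \in tau y]%SET.
  have U0 : U != finset.set0.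
    apply/set0Pn; case: (boolP (j \in tau y1)) jtau => j1 jtau.
      by exists y1; rewrite !inE y1S.
    by exists y0; rewrite !inE y0S; case: (j \in tau y0) jtau.
  have US : U \proper S.
    apply/properP; split; first by apply/fintype.subsetP => y; rewrite inE => /andP[].
    case: (boolP (j \in tau y1)) jtau => j1 jtau.
      by exists y0 => //; rewrite !inE y0S; case: (j \in tau y0) jtau.
    by exists y1 => //; rewrite !inE y1S.
  rewrite normrM !normr_prod (bigD1 j) //= -/U mulrCA.
  apply: (@le_trans _ _ `|corr i U|).
    rewrite ler_piMr // mulr_ile1 ?prodr_ge0 //.
      by apply: prodr_ile1 => y _; rewrite normr_ge0 fcoef_norm_le1.
    by apply: prodr_ile1 => l _; rewrite normr_ge0 corr_norm_le1.
  rewrite /rest (bigD1 U) ?U0 //= lerDl; exact: sumr_ge0.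
by rewrite sumr_const mulr_natl.
Qed.

End Growth.

(** * Limits *)

Section Limits.
Context {R : realType} {k n : nat}.
Variables (mu : boolfun n -> R) (alpha : boolfun k).
Hypothesis mu_distr : is_distr mu.
Hypothesis alpha_monotone : monotone_bf alpha.
Hypothesis alpha_selfdual : selfdual alpha.
Hypothesis alpha_nonprojection : alpha \notin projections k.

Lemma amplification_cvg (u : nat -> R) (l : R) :
  u i @[i --> \oo] --> l ->
  amplification alpha (u i) @[i --> \oo] --> amplification alpha l.
Proof.
move=> ul; rewrite /amplification.
apply: cvg_big => [|x _]; first exact: add_continuous.
apply: cvgM; last exact: cvg_cst.
rewrite /weightp.
apply: cvg_big => [|j _]; first exact: mul_continuous.
rewrite /bias; case: (x j) => //.
by apply: cvgB => //; apply: cvg_cst.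
Qed.

Lemma amplification0 : amplification alpha (0 : R) = 0.
Proof.
rewrite /amplification big1 // => x _.
have [ax|] := boolP (alpha x); last by rewrite mulr0.
have [i /andP[xi _]] := monotone_selfdual_intersecting alpha_monotone
  alpha_selfdual ax ax.
by rewrite /weightp (bigD1 i) //= /bias xi !mul0r.
Qed.

(** The sequence stays below 1/2 and is nonincreasing, so by continuity its limit is a fixed point
    of [amplification] in [0, 1/2), which can only be 0. *)
Lemma prob1_cvg0 y : prob1 mu alpha 0 y < 2^-1 ->
  prob1 mu alpha i y @[i --> \oo] --> 0.
Proof.
move=> y0; set u := fun i => prob1 mu alpha i y.
have u_ge0 i : 0 <= u i by case/andP: (prob1_bounds alpha mu_distr i y).
have le_amp (p : R) : 0 <= p < 2^-1 -> amplification alpha p <= p.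
  move=> /andP[]; rewrite le_eqVlt => /orP[/eqP <- _|p0 p1].
    by rewrite amplification0.
  by apply/ltW/amplification_lt => //; rewrite p0.
have u_half i : u i < 2^-1.
  elim: i => // i IH; rewrite /u prob1S //.
  by apply: (le_lt_trans _ IH); apply: le_amp; rewrite IH andbT; apply: u_ge0.
have u_noninc : {homo u : a b / (a <= b)%N >-> b <= a}.
  apply/nonincreasing_seqP => i.
  rewrite /u prob1S // le_amp //; apply/andP.
  by split; [exact: u_ge0 | exact: u_half].
have u_cvg : cvgn u.
  apply: nonincreasing_is_cvgn => //; exists 0 => _ [i _ <-]; exact: u_ge0.
have l_ge0 : 0 <= limn u by apply: limr_ge => //; apply: nearW.
have l_half : limn u < 2^-1.
  by apply: le_lt_trans (u_half 0%N); apply: nonincreasing_cvgn_ge.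
have fixpt : amplification alpha (limn u) = limn u.
  apply: (@cvg_unique _ _ (u (i + 1)%N @[i --> \oo])) => //.
    rewrite (_ : (fun i => u (i + 1)%N) = fun i => amplification alpha (u i)).
      exact: amplification_cvg.
    by apply/funext => i; rewrite addn1 /u prob1S.
  by move: u_cvg; rewrite -(cvg_shiftn 1 u).
have l0 : limn u = 0.
  apply/eqP/negPn/negP => l0.
  have : amplification alpha (limn u) < limn u.
    by apply: amplification_lt => //; rewrite l_half andbT lt_neqAle eq_sym l0.
  by rewrite fixpt ltxx.
by rewrite -[X in _ --> X]l0; exact: u_cvg.
Qed.

(** Strong induction on the size of [S] makes the error term of [corr_step] tend to 0. For pairs the
    error must vanish exactly, since the rate there depends on the current correlation; it does,
    because singletons have correlation 0 at all times. *)
Lemma corr_cvg0 (M : {set assignment n}) :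
  (forall y, y \in M -> corr mu alpha 0 [set y]%SET = 0) ->
  (forall S : {set assignment n}, S \subset M -> #|S| = 2 ->
     `|corr mu alpha 0 S| < 1) ->
  forall S : {set assignment n}, S \subset M -> S != finset.set0 ->
    corr mu alpha i S @[i --> \oo] --> 0.
Proof.
move=> M1 M2 S; have [m] := ubnP #|S|; elim: m S => // m IH S Sm SM S0.
have corr1 i y : y \in M -> corr mu alpha i [set y]%SET = 0.
  move=> yM; elim: i => [|i IHi]; first exact: M1.
  apply/eqP; rewrite -normr_le0.
  have y_in := set11 y.
  apply: le_trans (corr_step alpha mu_distr i y_in) _.
  rewrite [X in _ * X]big1 ?mulr0 ?addr0 => [|U /andP[U0 /proper_card]]; last first.
    by rewrite cards1 ltnS leqn0 cards_eq0 (negbTE U0).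
  rewrite big1 // => T _; rewrite IHi normr0 cards1.
  (* Here 0 ^ 0 = 1, so the empty set needs its coefficient to vanish. *)
  have [->|T0] := eqVneq T finset.set0; first by rewrite fcoef0 // normr0 mul0r.
  by rewrite expr0n cards_eq0 (negbTE T0) mulr0.
have [y0 y0S] := set0Pn _ S0.
have step i := corr_step alpha mu_distr i y0S.
have rest : #|{ffun assignment n -> {set 'I_k}}|%:R *
      \sum_(U : {set assignment n} | (U != finset.set0) && (U \proper S))
         `|corr mu alpha i U| @[i --> \oo] --> (0 : R).
  rewrite -[X in _ --> X](mulr0 (#|{ffun assignment n -> {set 'I_k}}|%:R : R)).
  apply: cvgM; first exact: cvg_cst.
  rewrite -[X in _ --> X](_ : \sum_(U : {set assignment n} |
    (U != finset.set0) && (U \proper S)) (0 : R) = 0); last by rewrite big1_eq.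
  apply: cvg_big => [|U /andP[U0 US]]; first exact: add_continuous.
  rewrite -[X in _ --> X](@normr0 _ R); apply: cvg_norm; apply: IH => //.
    by rewrite -ltnS; apply: leq_trans Sm; rewrite ltnS; apply: proper_card.
  exact: fintype.subset_trans (proper_sub US) SM.
apply: norm_cvg0.
have [S1|S1] := leqP #|S| 1.
  have /eqP/cards1P[y Sy] : #|S| = 1%N by apply/eqP; rewrite eqn_leq S1 card_gt0.
  rewrite (_ : (fun i => _) = fun=> 0); first exact: cvg_cst.
  apply/funext => i; rewrite Sy corr1 ?normr0 //.
  by apply: (fintype.subsetP SM); rewrite Sy set11.
have [S2|S2] := leqP #|S| 2.
  have {S1 S2}S2 : #|S| = 2 by apply/eqP; rewrite eqn_leq S2.
  have := fcoef_tail_bounds alpha_monotone alpha_selfdual alpha_nonprojection.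
  move=> /(_ R) /andP[t0 t1].
  set r := `|corr mu alpha 0 S|.
  have r1 : r < 1 by apply: M2.
  have r0 : 0 <= r by apply: normr_ge0.
  set t := fcoef_tail alpha in t0 t1.
  (* The rate at time 0; it stays valid because the correlation never exceeds its initial modulus
     [r]. *)
  pose lambda := 1 - (1 - r) * t.
  have l0 : 0 <= lambda.
    rewrite subr_ge0 mulr_ile1 ?(ltW t0) //; lra.
  have l1 : lambda < 1 by rewrite gtrDl oppr_lt0 mulr_gt0 // subr_gt0.
  have step2 i : `|corr mu alpha i.+1 S| <=
      (1 - (1 - `|corr mu alpha i S|) * t) * `|corr mu alpha i S|.
    apply: le_trans (step i) _.
    rewrite [X in _ + _ * X]big1 ?mulr0 ?addr0 => [|U /andP[U0 US]]; last first.
      have /eqP/cards1P[y Uy] : #|U| = 1%N.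
        by apply/eqP; rewrite eqn_leq card_gt0 U0 -ltnS (leq_trans (proper_card US)) ?S2.
      rewrite Uy corr1 ?normr0 //; apply: (fintype.subsetP SM).
      by apply: (fintype.subsetP (proper_sub US)); rewrite Uy set11.
    rewrite S2; apply: fcoef_contraction2 => //; exact: corr_norm_le1.
  have step_le i : `|corr mu alpha i S| <= r ->
      `|corr mu alpha i.+1 S| <= lambda * `|corr mu alpha i S|.
    move=> ir; apply: le_trans (step2 i) _; rewrite ler_wpM2r //.
    by rewrite lerD2l lerN2 ler_wpM2r ?(ltW t0) // lerD2l lerN2.
  have le_r i : `|corr mu alpha i S| <= r.
    elim: i => // i IHi; apply: le_trans (step_le _ IHi) _.
    by apply: le_trans IHi; rewrite ler_piMl // ltW.
  apply: (@cvg0_contraction _ _ (fun=> 0) lambda); rewrite ?l0 //.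
    by move=> i; rewrite addr0; apply: step_le.
  exact: cvg_cst.
apply: (cvg0_contraction (fcoef_cube_lt1 alpha_monotone alpha_selfdual
  alpha_nonprojection)) rest => // i.
apply: le_trans (step i) _; rewrite lerD2r.
apply: fcoef_contraction3 => //; exact: corr_norm_le1.
Qed.

End Limits.

(** * The initial distribution on the projections *)

Lemma weight_negate n (y : assignment n) :
  (weight y + weight (negate y))%N = n.
Proof.
rewrite /weight -[RHS]card_ord -(cardC [pred i | y i]); congr (_ + _)%N.
by apply: eq_card => i; rewrite !inE ffunE.
Qed.

Lemma projection_inj n : injective (@projection n).
Proof.
move=> i j /ffunP /(_ [ffun l => l == i]); rewrite !ffunE eqxx.
by move/esym/eqP.
Qed.

Section UniformProjections.
Context {R : realType} {n : nat}.
Variable mu : boolfun n -> R.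
Hypothesis mu_uniform : uniform_on mu (distr_support mu).
Hypothesis mu_support : distr_support mu = projections n.

Lemma sum_uniform_projections (F : boolfun n -> R) :
  \sum_f mu f * F f = n%:R^-1 * \sum_i F (projection i).
Proof.
have [_ muE] := mu_uniform.
have card_proj : #|projections n| = n.
  by rewrite card_imset ?card_ord //; apply: projection_inj.
rewrite (eq_bigr (fun f => if f \in projections n then n%:R^-1 * F f else 0));
  last first.
  move=> f _; rewrite muE mu_support card_proj; case: ifP => // _.
  by rewrite mul0r.
rewrite -big_mkcond /= big_imset /=; first by rewrite mulr_sumr.
by move=> i j _ _; apply: projection_inj.
Qed.

Lemma uniform_projections_gt0 : (0 < n)%N.
Proof.
have [[_ mu1] _] := mu_uniform.
have := sum_uniform_projections (fun=> 1).
under eq_bigr do rewrite mulr1.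
rewrite mu1 sumr_const card_ord; case: n => // /eqP.
by rewrite mulr0n mulr0 oner_eq0.
Qed.

Lemma uniform_projections_selfdual f : mu f != 0 -> selfdual f.
Proof.
move=> fnz; have : f \in projections n by rewrite -mu_support inE.
move=> /imsetP[i _ ->]; apply/forallP => y.
by rewrite !ffunE negbK.
Qed.

Lemma growth_mean0_projections k (alpha : boolfun k) F :
  growth_mean mu alpha 0 F = n%:R^-1 * \sum_i F (projection i).
Proof. exact: sum_uniform_projections. Qed.

Lemma prob1_projections k (alpha : boolfun k) y :
  prob1 mu alpha 0 y = n%:R^-1 * (weight y)%:R.
Proof.
rewrite /prob1 growth_mean0_projections; congr (_ * _).
rewrite -natr_sum; congr (_%:R); rewrite /weight -sum1_card.
rewrite [RHS]big_mkcond /=; apply: eq_bigr => i _.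
by rewrite ffunE inE; case: (y i).
Qed.

(** Exactly half of the projections are 1 at [y], so the signs cancel. *)
Lemma corr1_projections k (alpha : boolfun k) y :
  (weight y).*2 = n -> corr mu alpha 0 [set y]%SET = 0.
Proof.
move=> wy; rewrite /corr growth_mean0_projections.
have n0 : n%:R != 0 :> R by rewrite pnatr_eq0 -lt0n uniform_projections_gt0.
have := prob1_projections alpha y; rewrite /prob1 growth_mean0_projections.
move=> /(mulfI (invr_neq0 n0)) wE.
rewrite (eq_bigr (fun i => (projection i y)%:R *+ 2 - 1 : R)); last first.
  move=> i _; rewrite /charac big_set1 /sgn.
  by case: (projection i y) => /=; ring.
rewrite sumrB sumrMnl wE sumr_const card_ord -mulrnA muln2 wy.
by rewrite subrr mulr0.
Qed.

(** Projection [i] contributes 1 if [y] and [z] agree at [i] and -1 otherwise. Both signs occur: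
    agreement at [i0] rules out the pair [y], [negate y], whose correlation would be -1. *)
Lemma corr2_projections k (alpha : boolfun k) (y z : assignment n) i0 :
  y != z -> y i0 = z i0 -> `|corr mu alpha 0 [set y; z]%SET| < 1.
Proof.
move=> yz yzi0; rewrite /corr growth_mean0_projections.
have n0 : 0 < n%:R :> R by rewrite ltr0n uniform_projections_gt0.
rewrite normrM gtr0_norm ?invr_gt0 // ltr_pdivrMl // mulr1.
have [i1 yzi1] : exists i, y i != z i.
  apply/existsP; rewrite -negb_forall; apply: contra yz => /forallP H.
  by apply/eqP/ffunP => i; apply/eqP.
pose t i : R := charac (@sgn R) [set y; z]%SET (@projection n i).
rewrite (eq_bigr t) //.
have tE i : t i = if y i == z i then 1 else -1.
  rewrite /t /charac (big_setU1) ?inE //= big_set1 !ffunE /sgn.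
  by case: (y i); case: (z i); rewrite /=; ring.
have t_bounds i : -1 <= t i <= 1 by rewrite tE; case: ifP => _; lra.
have nE : n%:R = \sum_(i < n) (1 : R) by rewrite sumr_const card_ord.
rewrite ltr_norml; apply/andP; split.
  rewrite ltrNl -sumrN nE (bigD1 i0) //= [ltRHS](bigD1 i0) //= ltr_leD //.
    by rewrite tE yzi0 eqxx; lra.
  by apply: ler_sum => i _; have := t_bounds i; lra.
rewrite nE (bigD1 i1) //= [ltRHS](bigD1 i1) //= ltr_leD //.
  by rewrite tE (negbTE yzi1); lra.
by apply: ler_sum => i _; have := t_bounds i; lra.
Qed.

End UniformProjections.

(** * Fourier inversion for the values on a set of assignments *)

Section Agreement.
Context {R : realType} {k n : nat}.
Variables (mu : boolfun n -> R) (alpha : boolfun k).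

(** The indicator of agreement on [M] is the product over [M] of (1 + sgn (f y) sgn (h y)) / 2;
    expand it over subsets and take expectations. *)
Lemma sum_growth_agree i (M : {set assignment n}) (f : boolfun n) :
  \sum_(h : boolfun n | [forall y in M, h y == f y]) growth mu alpha i h
  = 2^-1 ^+ #|M| * \sum_(S : {set assignment n} | S \subset M)
      charac (@sgn R) S f * corr mu alpha i S.
Proof.
rewrite big_mkcond /=.
rewrite (eq_bigr (fun h => \sum_(S : {set assignment n} | S \subset M)
   2^-1 ^+ #|M| * (charac (@sgn R) S f *
     (growth mu alpha i h * charac (@sgn R) S h)))); last first.
  move=> h _; rewrite -mulr_sumr.
  have -> : \sum_(S : {set assignment n} | S \subset M) charac (@sgn R) S f *
      (growth mu alpha i h * charac (@sgn R) S h) = growth mu alpha i h *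
      \sum_(S : {set assignment n} | S \subset M)
        \prod_(y in S) (sgn (f y) * sgn (h y)).
    rewrite mulr_sumr; apply: eq_bigr => S _.
    by rewrite mulrCA; congr (_ * _); rewrite -big_split.
  rewrite -prod1D_subsets mulrCA -prodr_const -big_split /=.
  case: ifPn => [/forall_inP hf|].
    rewrite big1 ?mulr1 // => y /hf /eqP ->.
    by rewrite /sgn; case: (f y); field.
  rewrite negb_forall_in => /exists_inP[y yM hfy].
  rewrite (bigD1 y) //=.
  have -> : (1 + sgn (f y) * sgn (h y) : R) = 0.
    by rewrite /sgn; case: (f y) hfy; case: (h y) => //= _; ring.
  by rewrite mulr0 mul0r mulr0.
rewrite exchange_big /= mulr_sumr; apply: eq_bigr => S _.
by rewrite /corr /growth_mean -!mulr_sumr.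
Qed.

End Agreement.

(** * Convergence to the uniform distribution *)

Theorem theorem5p22 (R : realType) (k n : nat) (alpha : boolfun k)
    (mu : boolfun n -> R)
    (alpha_monotone : monotone_bf alpha)
    (alpha_selfdual : selfdual alpha)
    (alpha_nonprojection : alpha \notin projections k)
    (n_even : ~~ odd n)
    (mu_uniform : uniform_on mu (distr_support mu))
    (mu_support : distr_support mu = projections n) :
  exists p : boolfun n -> R,
    limiting_distribution mu alpha p /\
    uniform_on p [set f in slice n./2 n | selfdual f]%SET.
Proof.
have mu_distr : is_distr mu by case: mu_uniform.
have n_gt0 := uniform_projections_gt0 mu_uniform mu_support.
have n_half : (n./2).*2 = n by rewrite even_halfK.
pose i0 := Ordinal n_gt0.
(* Fixing the coordinate [i0] selects one assignment from each complementary pair in the middle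
   layer. *)
pose M : {set assignment n} :=
  [set y : assignment n | (weight y == n./2) && y i0]%SET.
set A := [set f in _ | _]%SET.
pose c : R := 2^-1 ^+ #|M|.
have low (y : assignment n) : (weight y < n./2)%N ->
    prob1 mu alpha i y @[i --> \oo] --> 0.
  move=> wy; apply: prob1_cvg0 => //.
  rewrite (prob1_projections mu_uniform mu_support).
  have n0 : 0 < n%:R :> R by rewrite ltr0n.
  rewrite ltr_pdivrMl // ltr_pdivlMr ?ltr0n // -natrM ltr_nat.
  by rewrite muln2 -[ltnRHS]n_half ltn_double.
have notA f : f \notin A -> growth mu alpha i f @[i --> \oo] --> 0.
  move=> fA; have [f_sd|f_sd] := boolP (selfdual f); last first.
    rewrite (_ : (fun i => _) = fun=> 0); first exact: cvg_cst.
    apply/funext => i; apply/eqP/negPn/negP => /growth_selfdual f_sd'.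
    move/negP: f_sd; apply; apply: f_sd' => // h.
    exact: uniform_projections_selfdual.
  (* A violation above the middle layer becomes one below it under [negate]. The mass of [f] is then
     at most the probability of the value 1 at [y]. *)
  have [y wy fy] : exists2 y : assignment n, (weight y < n./2)%N & f y.
    move: fA; rewrite /A /slice !inE f_sd andbT negb_forall => /existsP[y].
    rewrite negb_and !negb_imply andbT => /orP[] /andP[wy fy]; last by exists y.
    exists (negate y); last by rewrite selfdualE.
    by move: wy (weight_negate y); clear -n_half; lia.
  apply: (squeeze_cvgr _ (cvg_cst 0) (low y wy)); apply: nearW => i.
  rewrite growth_ge0 //= /prob1 /growth_mean (bigD1 f) //= fy mulr1 lerDl.
  by apply: sumr_ge0 => h _; rewrite mulr_ge0 ?growth_ge0.
have A_inj f h : f \in A -> h \in A -> (forall y, y \in M -> h y = f y) -> h = f.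
  rewrite /A /slice !inE => /andP[/forallP fS f_sd] /andP[/forallP hS h_sd] hf.
  apply/ffunP => y; have := fS y; have := hS y.
  have [wy|wy|wy] := ltngtP (weight y) n./2 => /=.
  - by move=> /negbTE -> /negbTE ->.
  - by rewrite !andbT => -> ->.
  move=> _ _; case: (boolP (y i0)) => yi0; first by apply: hf; rewrite inE wy eqxx.
  have : h (negate y) = f (negate y).
    apply: hf; rewrite inE ffunE yi0 andbT; apply/eqP.
    by move: wy (weight_negate y); clear -n_half; lia.
  by rewrite !selfdualE // => /negb_inj.
have corr0 (S : {set assignment n}) : S \subset M -> S != finset.set0 ->
    corr mu alpha i S @[i --> \oo] --> 0.
  apply: corr_cvg0 => //.
    move=> y; rewrite inE => /andP[/eqP wy _].
    by apply: corr1_projections => //; rewrite wy.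
  move=> T TM /eqP/cards2P[y [z [yz Tyz]]]; rewrite Tyz.
  have yi0 x : x \in T -> x i0 by move/(fintype.subsetP TM); rewrite inE => /andP[].
  apply: (@corr2_projections _ _ _ _ _ _ _ _ _ i0) => //.
  by rewrite !yi0 // Tyz !inE eqxx ?orbT.
(* Among the functions that agree with [f] on [M], only [f] lies in [A]. The class has limiting mass
   [c], as only the empty set survives in the expansion, and its other members have limiting mass
   0. *)
have inA f : f \in A -> growth mu alpha i f @[i --> \oo] --> c.
  move=> fA.
  rewrite (_ : (fun i => _) = fun i =>
      2^-1 ^+ #|M| * \sum_(S : {set assignment n} | S \subset M)
        charac (@sgn R) S f * corr mu alpha i S
      - \sum_(h : boolfun n | [forall y in M, h y == f y] && (h != f))
          growth mu alpha i h); last first.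
    apply/funext => i; rewrite -sum_growth_agree (bigD1 f) /= ?addrK //.
    by apply/forall_inP.
  rewrite -[X in _ --> X]subr0; apply: cvgB.
    rewrite -[X in _ --> X]mulr1; apply: cvgM; first exact: cvg_cst.
    rewrite -[X in _ --> X](_ : \sum_(S : {set assignment n} | S \subset M)
        (S == finset.set0)%:R = 1); last first.
      rewrite (bigD1 finset.set0) ?finset.sub0set //= eqxx big1 ?addr0 //.
      by move=> S /andP[_ /negbTE ->].
    apply: cvg_big => [|S SM]; first exact: add_continuous.
    have [->|S0] := eqVneq S finset.set0.
      rewrite (_ : (fun i => _) = fun=> 1); first exact: cvg_cst.
      by apply/funext => i; rewrite corr_set0 // /charac big_set0 mulr1.
    rewrite /= mulr0n -[X in _ --> X](mulr0 (charac (@sgn R) S f)).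
    by apply: cvgM; [exact: cvg_cst | exact: corr0].
  rewrite -[X in _ --> X](_ : \sum_(h : boolfun n |
    [forall y in M, h y == f y] && (h != f)) (0 : R) = 0); last by rewrite big1_eq.
  apply: cvg_big => [|h /andP[/forall_inP hf hneq]]; first exact: add_continuous.
  apply: notA; apply: contra hneq => hA; apply/eqP/A_inj => // y yM.
  exact/eqP/hf.
pose p f : R := if f \in A then c else 0.
have p_lim f : growth mu alpha i f @[i --> \oo] --> p f.
  by rewrite /p; case: ifPn => [/inA|/notA].
have p_sum : \sum_f p f = 1.
  apply: (@cvg_unique _ _ (\sum_f growth mu alpha i f @[i --> \oo])) => //.
    by apply: cvg_big => [|f _]; [exact: add_continuous | exact: p_lim].
  rewrite (_ : (fun i => _) = fun=> 1); first exact: cvg_cst.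
  by apply/funext => i; case: (growth_distr alpha mu_distr i).
exists p; split => //; split; first split => // f.
  by rewrite /p; case: ifP => // _; rewrite exprn_ge0 ?invr_ge0.
(* The size of [A] is read off from the total mass 1 rather than counted. *)
have cA : c * #|A|%:R = 1.
  by rewrite mulr_natr -p_sum /p -big_mkcond /= sumr_const.
move=> f; rewrite /p; case: ifP => // _.
have A0 : #|A|%:R != 0 :> R.
  by apply/eqP => A0; move/eqP: cA; rewrite A0 mulr0 eq_sym oner_eq0.
by rewrite -[LHS](mulfK A0) cA mul1r.
Qed.
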